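(* Let \[ L_3=\begin{pmatrix} 1&0&0&1&0\\ 0&0&0&0&1\\ 0&1&1&0&0 \end{pmatrix}. \] For every integer $n\geq 5$, \[ 6n-8\leq \operatorname{ex}(n,L_3)\leq 29n. \] Consequently, $\operatorname{ex}(n,L_3)=\Theta(n)$.
   Context: Rows of a matrix are ordered from top to bottom and columns from left to right. A $0$-$1$ matrix $M$ contains a $k\times\ell$ $0$-$1$ matrix $Q$ if there are row indices $i_1<\cdots<i_k$ and column indices $j_1<\cdots<j_\ell$ of $M$ such that $M_{i_a,j_b}=1$ whenever $Q_{a,b}=1$ (entries of $M$ at positions where $Q$ has a $0$ are unrestricted). If $M$ does not contain $Q$, then $M$ avoids $Q$. The weight $w(M)$ is the number of $1$ entries of $M$. $\operatorname{ex}(r,s,Q)$ denotes the largest weight of an $r\times s$ $0$-$1$ matrix avoiding $Q$, and $\operatorname{ex}(n,Q)=\operatorname{ex}(n,n,Q)$. *)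

(* Defs.v *)
From HB Require Import structures.
From mathcomp Require Import all_boot all_order all_algebra.
From mathcomp Require Import all_classical all_reals all_analysis.

Set Implicit Arguments.
Unset Strict Implicit.
Unset Printing Implicit Defensive.

(* 0-1 matrices are matrices over bool; true is the entry 1. *)

Definition ord_increasing (k r : nat) (f : {ffun 'I_k -> 'I_r}) : bool :=
  [forall a : 'I_k, forall b : 'I_k, (a < b)%N ==> (f a < f b)%N].

Definition contains (r s k l : nat) (M : 'M[bool]_(r, s)) (Q : 'M[bool]_(k, l))
    : bool :=
  [exists i : {ffun 'I_k -> 'I_r}, exists j : {ffun 'I_l -> 'I_s},
    [&& ord_increasing i, ord_increasing j &
        [forall a : 'I_k, forall b : 'I_l, Q a b ==> M (i a) (j b)]]].

Definition avoids (r s k l : nat) (M : 'M[bool]_(r, s)) (Q : 'M[bool]_(k, l))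
    : bool :=
  ~~ contains M Q.

Definition weight (r s : nat) (M : 'M[bool]_(r, s)) : nat :=
  #|[set p : 'I_r * 'I_s | M p.1 p.2]|.

(* If no r x s matrix avoids Q, which requires Q = 0, the value is 0. *)
Definition extremal_rect (r s k l : nat) (Q : 'M[bool]_(k, l)) : nat :=
  (\max_(M : 'M[bool]_(r, s) | avoids M Q) weight M)%N.

Definition extremal (n k l : nat) (Q : 'M[bool]_(k, l)) : nat :=
  extremal_rect n n Q.

Definition L3_rows : seq (seq nat) :=
  [:: [:: 1; 0; 0; 1; 0];
      [:: 0; 0; 0; 0; 1];
      [:: 0; 1; 1; 0; 0]]%N.

Definition L3 : 'M[bool]_(3, 5) :=
  (\matrix_(i < 3, j < 5) (nth 0%N (nth [::] L3_rows i) j == 1%N))%R.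

(* Main.v *)
(* Lower bound: fill the first and last rows and the first four columns; the
   entry in the middle row of L3 would then have to lie in one of those columns.

   Upper bound, in the form ex(r, s, L3) <= 2s + 5r: merging adjacent columns
   preserves L3-freeness, because every column of L3 has a single 1. Scan the
   rows from the top, and let the rows i < k already treated form a staircase:
   apart from one exceptional 1, all ones of row i lie weakly to the right of all
   ones of the rows i+1, ..., k. In row k let f be the first 1 and e the last 1
   that has a 1 of row k+1 strictly to its right. A row below k+1 has at most one
   1 strictly between f and e, as two of them would complete an L3 with top row k
   and middle row k+1; so has a row above k, by the staircase condition. Hence
   merging two columns strictly between f and e costs at most two ones, in rows k
   and k+1. Once e <= f + 2, either row k has at most three ones and is deleted,
   or erasing at most two of its ones extends the staircase to row k+1. A full
   staircase has at most s + 2r ones. *)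
Require Import Defs.
From HB Require Import structures.
From mathcomp Require Import all_boot all_order all_algebra.
From mathcomp Require Import all_classical all_reals all_analysis.
From mathcomp Require Import zify.
Import Order.TTheory GRing.Theory Num.Theory.
Import numFieldNormedType.Exports.

Set Implicit Arguments.
Unset Strict Implicit.
Unset Printing Implicit Defensive.

(** * Matrices, staircases and column maps over natural indices *)

Definition L3_free (M : nat -> nat -> bool) := forall a b c x1 x2 x3 x4 x5,
  a < b < c -> [&& x1 < x2, x2 < x3, x3 < x4 & x4 < x5] ->
  M a x1 -> M a x4 -> M b x5 -> M c x2 -> M c x3 -> False.

Definition supported r s (M : nat -> nat -> bool) :=
  forall i x, M i x -> i < r /\ x < s.

Definition ones r s (M : nat -> nat -> bool) := \sum_(i < r) \sum_(x < s) M i x.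

Definition staircase k (M : nat -> nat -> bool) :=
  forall i, i < k -> exists f, forall x, M i x ->
    x = f \/ forall j y, i < j <= k -> M j y -> y <= x.

(** One inclusion suffices, so this covers both merging columns and, with [phi] the identity,
    erasing ones. *)
Definition rowwise_image (phi : nat -> nat) (M' M : nat -> nat -> bool) :=
  forall i x, M' i x -> exists2 y, M i y & phi y = x.

Definition merge_cols c (M : nat -> nat -> bool) i x :=
  M i (bump c.+1 x) || (x == c) && M i c.+1.

Section Image.
Variables (phi : nat -> nat) (M' M : nat -> nat -> bool).
Hypothesis phi_mono : {homo phi : x y / x <= y}.
Hypothesis M'M : rowwise_image phi M' M.

(** A monotone [phi] reflects strict inequalities, so preimages of the five ones, chosen
    independently, keep their column order. *)
Lemma L3_free_image : L3_free M -> L3_free M'.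
Proof.
move=> free a b c ? ? ? ? ? abc lt_x.
move=> /M'M[x1 M1 e1] /M'M[x4 M4 e4] /M'M[x5 M5 e5] /M'M[x2 M2 e2] /M'M[x3 M3 e3].
have refl u v : phi u < phi v -> u < v.
  by rewrite !ltnNge; apply/contra/phi_mono.
move: lt_x; rewrite -e1 -e2 -e3 -e4 -e5 => /and4P[/refl l1 /refl l2 /refl l3 /refl l4].
by apply: (free _ _ _ x1 x2 x3 x4 x5 abc); rewrite ?l1 ?l2 ?l3.
Qed.

Lemma staircase_image k : staircase k M -> staircase k M'.
Proof.
move=> st i /st[f fP]; exists (phi f) => _ /M'M[x Mx <-].
have [->|le_x] := fP x Mx; first by left.
by right=> j _ ij /M'M[y My <-]; apply/phi_mono/(le_x j).
Qed.
End Image.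

(** * Counting ones under merging, deleting and erasing *)

Lemma merge_cols_image c M :
  rowwise_image (fun y => y - (c < y)) (merge_cols c M) M.
Proof.
move=> i x /orP[Mx|/andP[/eqP-> Mc]]; last by exists c.+1; rewrite // ltnSn subn1.
by exists (bump c.+1 x) => //; rewrite /bump; lia.
Qed.

Lemma supported_merge_cols r s c M : c < s ->
  supported r s.+1 M -> supported r s (merge_cols c M).
Proof.
move=> cs supp i x /orP[/supp|/andP[/eqP-> /supp]]; rewrite /bump; lia.
Qed.

Lemma ones_merge_cols r s c M : c < s ->
  ones r s.+1 M = ones r s (merge_cols c M) + \sum_(i < r) (M i c && M i c.+1).
Proof.
move=> cs; rewrite -big_split; apply: eq_bigr => i _ /=.
have cs1 : c.+1 < s.+1 by [].
rewrite (bigD1_ord (Ordinal cs1)) //= (bigD1 (Ordinal cs)) //=.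
rewrite [in RHS](bigD1 (Ordinal cs)) //= /merge_cols eqxx /= /bump ltnn add0n.
under [in RHS]eq_bigr => x xc.
  rewrite (_ : (x : nat) == c = false) ?orbF; first over.
  by apply: contraNF xc => /eqP xc; apply/eqP/val_inj.
set S := \sum_(_ < _ | _) _; rewrite -/S.
case: (M i c) (M i c.+1) => [] [] /=; lia.
Qed.

Lemma ones_delete_row r s k M : k < r.+1 ->
  ones r.+1 s M = \sum_(x < s) M k x + ones r s (fun i => M (bump k i)).
Proof. by move=> kr; rewrite /ones (bigD1_ord (Ordinal kr)). Qed.

Lemma ones_shrink_row r s k M A : k < r ->
  ones r s M <= ones r s (fun i x => M i x && ((i == k) ==> A x))
                + \sum_(x < s) (M k x && ~~ A x).
Proof.
move=> kr; rewrite /ones (bigD1 (Ordinal kr)) //=.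
rewrite [X in _ <= X + _](bigD1 (Ordinal kr)) //= eqxx /=.
rewrite addnAC -big_split /=; apply: leq_add; apply: leq_sum => i.
  by move=> _; case: (M k i); case: (A i).
move=> ik; apply: leq_sum => x _; rewrite (_ : (i : nat) == k = false) ?andbT //.
by apply: contraNF ik => /eqP ik; apply/eqP/val_inj.
Qed.

(** * Upper bound in the presence of a staircase *)

Lemma sum_row_le s (A : nat -> bool) (l : seq nat) :
  (forall x, A x -> x \in l) -> \sum_(x < s) A x <= size l.
Proof.
move=> Al; rewrite -(big_mkord xpredT (fun x => A x : nat)).
rewrite (eq_bigr (fun x => if A x then 1 else 0)); last by move=> x _; case: (A x).
rewrite -big_mkcond sum1_count -size_filter; apply: uniq_leq_size.
  by rewrite filter_uniq ?iota_uniq.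
by move=> x; rewrite mem_filter => /andP[/Al].
Qed.

(** Exceptional ones aside, successive rows occupy column ranges moving left that overlap in at most
    one column. Each row thus costs at most two beyond the columns it uses up: the overlap and its
    exceptional 1. *)
Lemma ones_staircase r s M : supported r s M -> staircase r M ->
  ones r s M <= s + 2 * r.
Proof.
move=> supp st.
(* m is a strict upper bound for the columns of the ones from row t on. *)
suff /(_ r (leqnn r))[m _] : forall t, t <= r ->
    exists2 m, (forall j y, t <= j -> M j y -> y < m) &
    \sum_(i < t) \sum_(x < s) M i x + m <= s + 2 * t.
  by rewrite /ones; lia.
elim=> [_|t IH lt_tr].
  by exists s; [move=> j y _ /supp[] | rewrite big_ord0; lia].
have [m below le_m] := IH (ltnW lt_tr).
have [f fP] := st t lt_tr; rewrite big_ord_recr /=.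
have [/existsP[x0 /andP[Mx0 x0f]]|none] :=
    boolP [exists x : 'I_s, M t x && (x != f :> nat)]; last first.
  exists m => [j y tj|]; first exact/below/ltnW.
  have : \sum_(x < s) M t x <= size [:: f].
    apply: sum_row_le => x Mx; have [_ xs] := supp _ _ Mx.
    rewrite inE; apply: contraR none => xf; apply/existsP.
    by exists (Ordinal xs); rewrite /= Mx.
  by move: (\sum_(x < s) M t x) (\sum_(i < t) _) le_m => /= u v; lia.
have exP : exists x, M t x && (x != f) by exists x0; rewrite Mx0.
case: (ex_minnP exP) => x /andP[Mx xf] min_x.
exists x.+1 => [j y tj My|].
  case: (fP _ Mx) => [/eqP|le_x]; first by rewrite (negPf xf).
  apply: (le_x j _ _ My); rewrite tj /=.
  by have [jr _] := supp _ _ My; apply: ltnW.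
have : \sum_(x < s) M t x <= size (f :: iota x (m - x)).
  apply: sum_row_le => y My; rewrite inE mem_iota.
  have [//|yf /=] := eqVneq y f.
  have := below t y (leqnn _) My; have := min_x y; rewrite My yf => /(_ isT); lia.
have := below t x (leqnn _) Mx; rewrite /= size_iota.
by move: (\sum_(x < s) M t x) (\sum_(i < t) _) le_m => u v; lia.
Qed.

(* The term 2 * (r - k) pays for the at most two ones erased whenever k grows. *)
Lemma ones_L3_free_staircase n r s k M :
  s + r + (r - k) <= n -> k <= r -> supported r s M -> L3_free M ->
  staircase k M -> ones r s M <= 2 * s + 3 * r + 2 * (r - k).
Proof.
(* Every move lowers the measure: a merge lowers [s], a deletion [r], and an extension of the
   staircase [r - k]. *)
elim: n r s k M => [|n IH] r s k M le_n le_kr supp free st.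
  by rewrite /ones (_ : r = 0) ?big_ord0 //; lia.
have [eq_kr|lt_kr] := eqVneq k r.
  by rewrite eq_kr in st *; have := ones_staircase supp st; lia.
have {lt_kr} lt_kr : k < r by lia.
have delete_k : \sum_(x < s) M k x <= 3 ->
    ones r s M <= 2 * s + 3 * r + 2 * (r - k).
  move=> row_k; case: r lt_kr le_kr supp le_n => [//|r] lt_kr le_kr supp le_n.
  rewrite (ones_delete_row s M lt_kr).
  (* The row moving up to index [k] was not covered by the staircase, hence [k.-1]. The drop in 3 *
     r pays for the three ones. *)
  have : ones r s (fun i => M (bump k i)) <= 2 * s + 3 * r + 2 * (r - k.-1).
    apply: IH; [lia|lia| | |].
    - by move=> i x /supp; rewrite /bump; lia.
    - by move=> a b c x1 x2 x3 x4 x5 abc; apply: free; rewrite /bump; lia.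
    - move=> i ik; have [|f fP] := st i; first lia.
      exists f => x; rewrite /bump leqNgt (_ : i < k); last by lia.
      move=> /fP[|le_x]; [by left | right=> j y ij].
      by apply: le_x; rewrite /bump; lia.
  lia.
have next_k M' : supported r s M' -> L3_free M' -> staircase k.+1 M' ->
    ones r s M' <= 2 * s + 3 * r + 2 * (r - k.+1).
  by move=> *; apply: IH => //; lia.
(* Row [k] must be nonempty, since row [k.+1] is compared with the earlier rows through a 1 of row
   [k]. *)
have [/existsP[z Mz]|empty_k] := boolP [exists x : 'I_s, M k x]; last first.
  apply: delete_k; rewrite big1 // => x _; apply/eqP; rewrite eqb0.
  by apply: contra empty_k => Mx; apply/existsP; exists x.
have [f Mf min_f] := ex_minnP (ex_intro (M k) _ Mz).
have [/existsP[e0 /andP[Me0 /existsP[y0 /andP[My0 lt_y0]]]]|no_e] :=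
    boolP [exists e : 'I_s, M k e && [exists y : 'I_s, M k.+1 y && (e < y)]];
  last first.
  (* Row [k.+1] lies weakly left of row [k], so the staircase extends with nothing erased. *)
  apply: leq_trans (next_k M supp free _) _; last by lia.
  have le_row x y : M k x -> M k.+1 y -> y <= x.
    move=> Mx My; rewrite leqNgt; apply: contra no_e => lt_xy.
    have [[_ xs] [_ ys]] := (supp _ _ Mx, supp _ _ My).
    apply/existsP; exists (Ordinal xs); rewrite /= Mx.
    by apply/existsP; exists (Ordinal ys); rewrite /= My.
  move=> i lt_ik; have [eq_ik|ik] := eqVneq i k.
    exists 0 => x; rewrite eq_ik => Mx; right=> j y; rewrite -eqn_leq => /eqP<-.
    exact: le_row.
  have {ik} lt_ik' : i < k by lia.
  have [g gP] := st i lt_ik'; exists g => x /gP[|le_x]; [by left | right=> j y ij].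
  have [-> /(le_row _ _ Mf)/leq_trans|jk] := eqVneq j k.+1; last by apply: le_x; lia.
  by apply; apply: le_x Mf; rewrite lt_ik' /=.
have exP : exists e, M k e && [exists y : 'I_s, M k.+1 y && (e < y)].
  by exists e0; rewrite Me0; apply/existsP; exists y0; rewrite My0.
have leP e : M k e && [exists y : 'I_s, M k.+1 y && (e < y)] -> e <= s.
  by move=> /andP[/supp[_ /ltnW]].
have [e /andP[Me /existsP[y1 /andP[My1 lt_y1]]] max_e] := ex_maxnP exP leP.
have below_e x y : M k x -> e < x -> M k.+1 y -> y <= x.
  move=> Mx lt_ex My; rewrite leqNgt; apply: contraL lt_ex => lt_xy.
  have [_ ys] := supp _ _ My.
  rewrite -leqNgt; apply: max_e; rewrite Mx; apply/existsP.
  by exists (Ordinal ys); rewrite /= My.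
have [lt_fe|le_ef] := ltnP f.+2 e.
  have [_ lt_es] := supp _ _ Me.
  case: s supp e0 y0 y1 z lt_es le_n {Mz Me0 My0 lt_y0 exP leP max_e} My1 lt_y1
    delete_k next_k => [//|s] supp e0 y0 y1 z lt_es le_n My1 lt_y1 _ _.
  (* The columns to merge are [f.+1] and [f.+2], both strictly between [f] and [e]. *)
  have lt_fs : f.+1 < s by lia.
  rewrite (ones_merge_cols r M lt_fs).
  have row_le1 (i : 'I_r) : (i != k :> nat) && (i != k.+1 :> nat) ->
      ~~ (M i f.+1 && M i f.+2).
    case/andP=> ik ik1; apply/negP => /andP[M1 M2].
    have [lt_ik|lt_ki|/eqP] := ltngtP i k; last by rewrite (negPf ik).
      have [g gP] := st i lt_ik.
      (* A 1 of row [i] left of the 1 of row [k] at [e] must be exceptional, and a row has only one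
         such. *)
      have le_e x : M i x -> x <= f.+2 -> x = g.
        move=> /gP[//|le_x]; have := le_x k e; rewrite lt_ik leqnn => /(_ isT Me).
        by lia.
      have := le_e _ M1; have := le_e _ M2; lia.
    apply: (free k k.+1 i f f.+1 f.+2 e y1) => //; first by lia.
    by rewrite !ltnSn lt_fe lt_y1.
  (* The drop of 2 in 2 * s pays for the ones lost in these two rows. *)
  have : \sum_(i < r) (M i f.+1 && M i f.+2) <= size [:: k; k.+1].
    pose A i := [&& M i f.+1, M i f.+2 & (i == k) || (i == k.+1)].
    rewrite (eq_bigr (fun i : 'I_r => A i : nat)).
      by apply: sum_row_le => i /and3P[_ _]; rewrite !inE.
    move=> i _; rewrite /A andbA; case: orP => [|/orP]; first by rewrite andbT.
    by rewrite negb_or => /row_le1/negPf->.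
  have : ones r s (merge_cols f.+1 M) <= 2 * s + 3 * r + 2 * (r - k).
    have phi_mono : {homo (fun y => y - (f.+1 < y)) : x y / x <= y}.
      by move=> x y; lia.
    have imM := @merge_cols_image f.+1 M.
    apply: IH => //.
    - exact: supported_merge_cols.
    - exact: (L3_free_image phi_mono imM).
    - exact: (staircase_image phi_mono imM).
  rewrite /=; lia.
have row_le x : M k x -> x <= e -> x \in [:: f; f.+1; f.+2].
  move=> /min_f le_fx le_xe; rewrite !inE; lia.
(* A 1 of row [k] at [w], right of [e], survives the erasing below and separates row [k.+1] from the
   earlier rows. Without it, row [k] has at most three ones. *)
have [/existsP[w /andP[Mw lt_w]]|last_e] := boolP [exists w : 'I_s, M k w && (e < w)];
  last first.
  apply: delete_k; apply: (@sum_row_le s (M k) [:: f; f.+1; f.+2]) => x Mx.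
  have [_ xs] := supp _ _ Mx.
  apply: row_le => //; rewrite leqNgt; apply: contra last_e => lt_ex.
  by apply/existsP; exists (Ordinal xs); rewrite /= Mx.
(* The 1 at [f] is kept as the exceptional one; by [below_e], those right of [e] already satisfy the
   staircase condition. *)
pose A x := (x == f) || (e < x).
apply: leq_trans (ones_shrink_row s M A lt_kr) _.
set M' := fun i x => _.
have M'M : rowwise_image id M' M by move=> i x /andP[Mx _]; exists x.
have : \sum_(x < s) (M k x && ~~ A x) <= size [:: f.+1; f.+2].
  apply: (@sum_row_le s (fun x => M k x && ~~ A x)) => x /andP[Mx].
  rewrite negb_or -leqNgt => /andP[/negPf xf /(row_le _ Mx)].
  by rewrite inE xf.
have : ones r s M' <= 2 * s + 3 * r + 2 * (r - k.+1).
  apply: next_k.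
  - by move=> i x /andP[/supp].
  - exact: (L3_free_image _ M'M).
  have st' : staircase k M' by apply: (staircase_image _ M'M).
  move=> i lt_ik; have [eq_ik|ik] := eqVneq i k.
    exists f => x; rewrite /M' eq_ik eqxx => /andP[Mx /orP[/eqP|lt_ex]].
      by left.
    right=> j y; rewrite -eqn_leq => /eqP<- /andP[My _]; exact: below_e My.
  have {ik} lt_ik' : i < k by lia.
  have [g gP] := st i lt_ik'; exists g => x /andP[/gP[xg|le_x] _]; [by left|].
  right=> j y ij /andP[My _].
  have [eq_j|jk] := eqVneq j k.+1; last by apply: le_x My; lia.
  rewrite eq_j in My; apply: leq_trans (below_e _ _ Mw lt_w My) _.
  by apply: le_x Mw; rewrite lt_ik' /=.
rewrite /=; lia.
Qed.

(** * Transfer to matrices over [bool], padded with zeros *)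

Definition entries r s (M : 'M[bool]_(r, s)) i x :=
  [exists p : 'I_r * 'I_s, [&& p.1 == i :> nat, p.2 == x :> nat & M p.1 p.2]].

Lemma entriesE r s (M : 'M[bool]_(r, s)) (i : 'I_r) (x : 'I_s) :
  entries M i x = M i x.
Proof.
apply/existsP/idP => [[[a b] /and3P[]]|Mix]; last by exists (i, x); rewrite !eqxx.
by move=> /eqP/val_inj/= -> /eqP/val_inj/= ->.
Qed.

Lemma entriesP r s (M : 'M[bool]_(r, s)) i x : entries M i x ->
  exists (a : 'I_r) (b : 'I_s), [/\ a = i :> nat, b = x :> nat & M a b].
Proof. by case/existsP=> -[a b] /and3P[/eqP ? /eqP ? ?]; exists a, b. Qed.

Lemma weightE r s (M : 'M[bool]_(r, s)) : weight M = ones r s (entries M).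
Proof.
rewrite /weight /ones pair_big /= -sum1_card big_mkcond /=; apply: eq_bigr => p _.
by rewrite inE entriesE; case: (M _ _).
Qed.

Lemma avoids_L3_free r s (M : 'M[bool]_(r, s)) : avoids M L3 -> L3_free (entries M).
Proof.
move=> /negP avM a b c x1 x2 x3 x4 x5 /andP[ab bc] /and4P[l1 l2 l3 l4].
move=> /entriesP[a1 [y1 [ea1 e1 M1]]] /entriesP[a4 [y4 [ea4 e4 M4]]].
move=> /entriesP[b5 [y5 [eb5 e5 M5]]].
move=> /entriesP[c2 [y2 [ec2 e2 M2]]] /entriesP[c3 [y3 [ec3 e3 M3]]].
have e41 : a4 = a1 by apply: val_inj; rewrite /= ea4.
have e32 : c3 = c2 by apply: val_inj; rewrite /= ec3.
subst; apply: avM; apply/existsP.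
exists [ffun i : 'I_3 => nth a1 [:: a1; b5; c2] i]; apply/existsP.
exists [ffun j : 'I_5 => nth y1 [:: y1; y2; y3; y4; y5] j]; apply/and3P; split.
- apply/forallP => -[[|[|[|//]]] ?]; apply/forallP => -[[|[|[|//]]] ?];
    rewrite !ffunE //=; lia.
- apply/forallP => -[[|[|[|[|[|//]]]]] ?]; apply/forallP => -[[|[|[|[|[|//]]]]] ?];
    rewrite !ffunE //=; lia.
by apply/forallP => -[[|[|[|//]]] ?]; apply/forallP => -[[|[|[|[|[|//]]]]] ?];
  rewrite !ffunE !mxE /=.
Qed.

Lemma extremal_rect_L3_le r s : extremal_rect r s L3 <= 2 * s + 5 * r.
Proof.
apply/bigmax_leqP => M /avoids_L3_free free; rewrite weightE.
have supp : supported r s (entries M).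
  by move=> i x /entriesP[a [b [<- <- _]]].
(* With no row treated the condition is vacuous, and the bound reads 2 * s + 3 * r + 2 * r. *)
have st : staircase 0 (entries M) by [].
have := ones_L3_free_staircase (leqnn _) (leq0n r) supp free st.
by rewrite subn0; lia.
Qed.

(** * The construction for the lower bound *)

Lemma extremal_L3_ge n : 4 <= n -> 6 * n - 8 <= extremal n L3.
Proof.
move=> n4.
pose M : 'M[bool]_n := (\matrix_(i < n, j < n) [|| i == 0%N :> nat, i.+1 == n | (j < 4)%N])%R.
have avM : avoids M L3.
  apply/negP => /existsP[f /existsP[g /and3P[/forallP f_inc /forallP g_inc fg]]].
  have f_lt a b := implyP (forallP (f_inc a) b).
  have g_lt a b := implyP (forallP (g_inc a) b).
  (* The middle 1 of [L3] lands in neither the first nor the last row and in a column of index at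
     least 4, where [M] is 0. *)
  have := implyP (forallP (forallP fg (inord 1)) (inord 4)).
  rewrite !mxE !inordK // => /(_ isT).
  have := f_lt (inord 0) (inord 1); have := f_lt (inord 1) (inord 2).
  have := g_lt (inord 0) (inord 1); have := g_lt (inord 1) (inord 2).
  have := g_lt (inord 2) (inord 3); have := g_lt (inord 3) (inord 4).
  rewrite !inordK //; have := ltn_ord (f (inord 2)).
  move: (f (inord 0) : nat) (f (inord 1) : nat) (f (inord 2) : nat) => f0 f1 f2.
  move: (g (inord 0) : nat) (g (inord 1) : nat) (g (inord 2) : nat) => g0 g1 g2.
  move: (g (inord 3) : nat) (g (inord 4) : nat) => g3 g4; lia.
apply: (@leq_trans (weight M)); last exact: leq_bigmax_cond.
have row_ge (i : 'I_n) : 4 <= \sum_(j < n) M i j.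
  rewrite /M {avM M}; case: n n4 i => [|[|[|[|n]]]] // _ i.
  by rewrite 4!big_ord_recl !mxE /= !orbT.
have row_full (i : 'I_n) : (i == 0 :> nat) || (i.+1 == n) -> \sum_(j < n) M i j = n.
  move=> full; transitivity (\sum_(j < n) 1); last by rewrite sum1_card card_ord.
  by apply: eq_bigr => j _; rewrite mxE orbA full.
have -> : weight M = \sum_(i < n) \sum_(j < n) M i j.
  rewrite weightE; apply: eq_bigr => i _; apply: eq_bigr => j _.
  by rewrite entriesE.
move: (M) row_ge row_full; case: n n4 {M avM} => [|[|n]] // n4 M row_ge row_full.
(* Two full rows and n - 2 rows with at least four ones give 2 * n + 4 * (n - 2) = 6 * n - 8. *)
rewrite big_ord_recl row_full // big_ord_recr row_full /=; last by rewrite /bump; lia.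
have : \sum_(i < n) 4 <=
    \sum_(i < n) \sum_(j < n.+2) M (lift ord0 (widen_ord (leqnSn n) i)) j.
  by apply: leq_sum => i _; apply: row_ge.
rewrite sum_nat_const card_ord; set S := \sum_(i < n) _; lia.
Qed.

Local Open Scope ring_scope.
Local Open Scope classical_set_scope.

Theorem theorem1p1 (R : realType) :
  (forall n : nat, (5 <= n)%N ->
     (6 * n - 8 <= extremal n L3 <= 29 * n)%N) /\
  (fun n : nat => (extremal n L3)%:R : R) \is 'Theta_\oo (fun n : nat => n%:R : R).
Proof.
have bounds n : (5 <= n)%N -> (6 * n - 8 <= extremal n L3 <= 29 * n)%N.
  move=> n5; rewrite extremal_L3_ge 1?ltnW //.
  (* The rectangular bound gives 7 * n, stronger than 29 * n. *)
  by have := extremal_rect_L3_le n n; rewrite -/(extremal n L3); lia.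
split=> //; rewrite qualifE; apply/asboolP; exists (1, 29) => /=.
  by rewrite ltr01 ltr0n.
(* The lower constant 1 works because n <= 6 * n - 8 in this range. *)
exists 5%N => // n /= /[dup] n5 /bounds; set m := extremal n L3 => m_bounds.
by rewrite mul1r !normr_nat -natrM !ler_nat; lia.
Qed.
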